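(* Every product-union congestion game has a monotone equilibrium selection (MES): for each demand vector $\mu$ there is an equilibrium load vector $x(\mu)$ such that every map $\mu\mapsto x_r(\mu)$ is nondecreasing with respect to each component of $\mu$.
   Context: A congestion game structure $\mathcal G=(\mathcal R,c,\mathcal S)$: finite resource set $\mathcal R$ with continuous nondecreasing costs $c_r:\mathbb R_+\to\mathbb R_+$, finite commodity set $\mathcal H$, each $h$ with a nonempty finite family $\mathcal S^h\subseteq2^{\mathcal R}$ of strategies. For demand $\mu\in\mathbb R_+^{\mathcal H}$, a feasible flow is $f=(f^h_s)$, $f^h_s\ge0$, $\sum_{s\in\mathcal S^h}f^h_s=\mu^h$; loads $x_r=\sum_h\sum_{s\in\mathcal S^h:r\in s}f^h_s$; strategy cost $c_s=\sum_{r\in s}c_r(x_r)$. A Wardrop equilibrium is a feasible flow with, for each $h$, some $\lambda^h$ such that $c_s=\lambda^h$ whenever $f^h_s>0$ and $c_s\ge\lambda^h$ for all $s\in\mathcal S^h$; equilibrium load vectors are load vectors of Wardrop equilibria. A singleton congestion game is one in which every strategy is a single resource. For two structures $\mathcal G_1=(\mathcal R_1,c_1,\mathcal S_1)$, $\mathcal G_2=(\mathcal R_2,c_2,\mathcal S_2)$ with disjoint resource sets and commodity sets $\mathcal H_1,\mathcal H_2$: the product $\mathcal G_1\otimes\mathcal G_2$ has resources $\mathcal R_1\cup\mathcal R_2$ with the original costs and commodities $i\otimes j$ for $(i,j)\in\mathcal H_1\times\mathcal H_2$ with strategy sets $\mathcal S^{i\otimes j}=\{s_1\cup s_2:(s_1,s_2)\in\mathcal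 S_1^i\times\mathcal S_2^j\}$; the union $\mathcal G_1\cup\mathcal G_2$ has resources $\mathcal R_1\cup\mathcal R_2$ with original costs and commodities $\mathcal H_1\sqcup\mathcal H_2$ with their original strategy sets. A product-union game is one obtained from singleton congestion games by finitely many product or union operations. *)

(* Defs.v *)
From HB Require Import structures.
From mathcomp Require Import classical_sets boolp reals topology normedtype.
From mathcomp Require Import all_boot all_order all_algebra.
Set Implicit Arguments. Unset Strict Implicit. Unset Printing Implicit Defensive.
Import Order.TTheory GRing.Theory Num.Theory.
Import numFieldNormedType.Exports.
Local Open Scope ring_scope.

Section Congestion.
Variable R : realType.

Unset Implicit Arguments.
Record cgame := CGame {
  res : finType;
  com : finType;
  strat : com -> {set {set res}};
  cost : res -> R -> R }.
Set Implicit Arguments.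

Definition wf_game (G : cgame) : Prop :=
  (forall h, strat G h != set0) /\
  (forall r, (forall x, 0 <= x -> 0 <= cost G r x) /\
     (forall x y, 0 <= x -> x <= y -> cost G r x <= cost G r y) /\
     {within [set x : R | 0 <= x]%classic, continuous (cost G r)}%classic).

Definition singleton_game (G : cgame) : Prop :=
  forall h s, s \in strat G h -> exists r, s = [set r].

Definition cost_sum (G1 G2 : cgame) (r : (res G1 + res G2)%type) : R -> R :=
  match r with inl r1 => cost G1 r1 | inr r2 => cost G2 r2 end.

Definition prod_game (G1 G2 : cgame) : cgame :=
  @CGame (res G1 + res G2)%type (com G1 * com G2)%type
    (fun ij => [set (@inl _ (res G2)) @: s1 :|: (@inr (res G1) _) @: s2
                 | s1 : {set res G1} in strat G1 ij.1, s2 : {set res G2} in strat G2 ij.2])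
    (@cost_sum G1 G2).

Definition strat_sum (G1 G2 : cgame) (h : (com G1 + com G2)%type)
  : {set {set (res G1 + res G2)%type}} :=
  match h with
  | inl i => [set (@inl _ (res G2)) @: s | s : {set res G1} in strat G1 i]
  | inr j => [set (@inr (res G1) _) @: s | s : {set res G2} in strat G2 j]
  end.

Definition union_game (G1 G2 : cgame) : cgame :=
  @CGame (res G1 + res G2)%type (com G1 + com G2)%type
    (@strat_sum G1 G2) (@cost_sum G1 G2).

Definition game_iso (G G' : cgame) : Prop :=
  exists (fR : res G -> res G') (fH : com G -> com G'),
    bijective fR /\ bijective fH /\
    (forall h, strat G' (fH h) = [set fR @: s | s : {set res G} in strat G h]) /\
    (forall r, cost G' (fR r) = cost G r).

Inductive product_union : cgame -> Prop :=
| PU_singleton G : wf_game G -> singleton_game G -> product_union G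
| PU_prod G1 G2 : product_union G1 -> product_union G2 ->
    product_union (prod_game G1 G2)
| PU_union G1 G2 : product_union G1 -> product_union G2 ->
    product_union (union_game G1 G2)
| PU_iso G G' : product_union G -> game_iso G G' -> product_union G'.

Variable G : cgame.

(* flows: f h s = flow of commodity h on strategy s (only s in S^h matter) *)
Definition feasible (mu : com G -> R) (f : com G -> {set res G} -> R) : Prop :=
  forall h, (forall s, s \in strat G h -> 0 <= f h s) /\
            \sum_(s in strat G h) f h s = mu h.

Definition load (f : com G -> {set res G} -> R) (r : res G) : R :=
  \sum_h \sum_(s in strat G h | r \in s) f h s.

Definition strat_cost (f : com G -> {set res G} -> R) (s : {set res G}) : R :=
  \sum_(r in s) cost G r (load f r).

Definition wardrop (mu : com G -> R) (f : com G -> {set res G} -> R) : Prop :=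
  feasible mu f /\
  forall h, exists lam : R, forall s, s \in strat G h ->
    (0 < f h s -> strat_cost f s = lam) /\ lam <= strat_cost f s.

Definition eq_load (mu : com G -> R) (x : res G -> R) : Prop :=
  exists f, wardrop mu f /\ forall r, load f r = x r.

Definition has_MES : Prop :=
  exists x : (com G -> R) -> res G -> R,
    (forall mu, (forall h, 0 <= mu h) -> eq_load mu (x mu)) /\
    (forall r h mu mu', (forall h', 0 <= mu h') -> (forall h', 0 <= mu' h') ->
       (forall h', h' != h -> mu h' = mu' h') -> mu h <= mu' h ->
       x mu r <= x mu' r).

End Congestion.

(* Main.v *)
(** Loads of a product or a union are read off from its factors: in a product,
    [mu_ij f1_i(s1) f2_j(s2) / (mu1_i mu2_j)], with [mu1], [mu2] the marginals
    of the demand, is an equilibrium flow whose loads are those of [f1] and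
    [f2], and the marginals increase with the demand. This leaves singleton
    games. If their costs are strictly increasing, an exchange argument shows
    that equilibrium loads are nondecreasing in the demand. In general, add
    [x / (n + 1)] to each cost and take the limit along one ultrafilter,
    common to all demands: limits of equilibria are equilibria and limits
    preserve inequalities. Existence of equilibria is obtained by a limit of
    the same kind, from atomic games whose players have weight [1 / (n + 1)]
    and which have equilibria by minimization of Rosenthal's potential. *)
Require Import Defs.
From mathcomp Require Import classical_sets boolp topology normedtype sequences.
From mathcomp Require Import all_boot all_order all_algebra reals lra.
Set Implicit Arguments. Unset Strict Implicit. Unset Printing Implicit Defensive.
Import Order.TTheory GRing.Theory Num.Theory.
Import numFieldNormedType.Exports.
Local Open Scope ring_scope.
#[local] Arguments res {R}.
#[local] Arguments com {R}.
#[local] Arguments strat {R}.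
#[local] Arguments cost {R}.

(** * Subsets of a disjoint union and sums over them *)

Section DisjointUnion.
Variables X Y : finType.
Implicit Types (A : {set X}) (B : {set Y}).

Lemma mem_inl_setU A B x :
  (inl x \in (@inl X Y) @: A :|: (@inr X Y) @: B) = (x \in A).
Proof.
rewrite !inE mem_imset; last exact: inl_inj.
by case: imsetP => [[y _ //]|_]; rewrite orbF.
Qed.

Lemma mem_inr_setU A B y :
  (inr y \in (@inl X Y) @: A :|: (@inr X Y) @: B) = (y \in B).
Proof.
rewrite !inE mem_imset; last exact: inr_inj.
by case: imsetP => [[x _ //]|_].
Qed.

Lemma preim_inl_setU A B :
  (@inl X Y) @^-1: ((@inl X Y) @: A :|: (@inr X Y) @: B) = A.
Proof. by apply/setP => x; rewrite inE mem_inl_setU. Qed.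

Lemma preim_inr_setU A B :
  (@inr X Y) @^-1: ((@inl X Y) @: A :|: (@inr X Y) @: B) = B.
Proof. by apply/setP => y; rewrite inE mem_inr_setU. Qed.

Lemma sum_setU_inl_inr (V : nmodType) A B (F : X + Y -> V) :
  \sum_(r in (@inl X Y) @: A :|: (@inr X Y) @: B) F r =
  \sum_(r in A) F (inl r) + \sum_(r in B) F (inr r).
Proof.
rewrite big_sumType /=; congr (_ + _); apply: eq_bigl => r.
  exact: mem_inl_setU.
exact: mem_inr_setU.
Qed.

(** Preimages under [inl] and [inr] recover [s1] and [s2] from their union, so strategies of a
    product correspond one-to-one to pairs. The filter [P] serves for load sums, which keep only the
    strategies through a given resource. *)
Lemma sum_imset2_setU (V : nmodType) (SX : {set {set X}}) (SY : {set {set Y}})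
    (P : pred {set X + Y}) (F : {set X + Y} -> V) :
  \sum_(s in [set (@inl X Y) @: s1 :|: (@inr X Y) @: s2
               | s1 : {set X} in SX, s2 : {set Y} in SY] | P s) F s =
  \sum_(s1 in SX) \sum_(s2 in SY | P ((@inl X Y) @: s1 :|: (@inr X Y) @: s2))
    F ((@inl X Y) @: s1 :|: (@inr X Y) @: s2).
Proof.
rewrite curry_imset2X.
rewrite big_mkcondr /= big_imset /=; last first.
  move=> [a b] [c d] _ _ /= e; congr (_, _).
    by rewrite -(preim_inl_setU a b) e preim_inl_setU.
  by rewrite -(preim_inr_setU a b) e preim_inr_setU.
under [RHS]eq_bigr => s1 _ do rewrite big_mkcondr.
by rewrite pair_big_dep /=; apply: eq_big => -[a b]; rewrite ?inE.
Qed.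

End DisjointUnion.

(** * Unions of games *)

Section Union.
Variables (R : realType) (G1 G2 : cgame R).

(** Commodities of one component never load resources of the other, so equilibria of the components,
    placed side by side, do not interact. *)
Lemma union_game_MES : has_MES G1 -> has_MES G2 -> has_MES (union_game G1 G2).
Proof.
move=> [x1 [eq1 mon1]] [x2 [eq2 mon2]].
exists (fun mu r => match r with inl r1 => x1 (mu \o inl) r1
                               | inr r2 => x2 (mu \o inr) r2 end).
split=> [mu mu0|]; last first.
  move=> r h mu mu' mu0 mu'0 eqmu lemu.
  case: r => r.
    case: h eqmu lemu => h eqmu lemu.
      by apply: (mon1 r h) => [h'|h'|h' hh'|//]; [exact: mu0|exact: mu'0|exact: eqmu].
    (* The varied commodity lies in the other component, so the demand seen here is unchanged. *)
    have -> : mu \o inl = mu' \o inl :> (com G1 -> R).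
      by apply: boolp.funext => h' /=; apply: eqmu.
    exact: lexx.
  case: h eqmu lemu => h eqmu lemu.
    have -> : mu \o inr = mu' \o inr :> (com G2 -> R).
      by apply: boolp.funext => h' /=; apply: eqmu.
    exact: lexx.
  by apply: (mon2 r h) => [h'|h'|h' hh'|//]; [exact: mu0|exact: mu'0|exact: eqmu].
have [f1 [[fea1 war1] ld1]] := eq1 (mu \o inl) (fun=> mu0 _).
have [f2 [[fea2 war2] ld2]] := eq2 (mu \o inr) (fun=> mu0 _).
pose f (h : com (union_game G1 G2)) (s : {set res (union_game G1 G2)}) :=
  match h with inl h1 => f1 h1 (inl @^-1: s) | inr h2 => f2 h2 (inr @^-1: s) end.
have preiml (A : {set res G1}) : inl @^-1: ((@inl _ (res G2)) @: A) = A.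
  by rewrite -[RHS](preim_inl_setU A (set0 : {set res G2})) imset0 setU0.
have preimr (A : {set res G2}) : inr @^-1: ((@inr (res G1) _) @: A) = A.
  by rewrite -[RHS](preim_inr_setU (set0 : {set res G1}) A) imset0 set0U.
have loadl r : load f (inl r) = load f1 r.
  rewrite /load big_sumType /= [X in _ + X]big1 ?addr0; last first.
    move=> j _; apply: big1 => s /andP[/imsetP[s2 _ ->]].
    by case/imsetP.
  apply: eq_bigr => i _; rewrite big_mkcondr big_imset /=; last first.
    by move=> a b _ _ e; rewrite -(preiml a) e preiml.
  rewrite [RHS]big_mkcondr; apply: eq_bigr => s _.
  by rewrite preiml mem_imset //; exact: inl_inj.
have loadr r : load f (inr r) = load f2 r.
  rewrite /load big_sumType /= [X in X + _]big1 ?add0r; last first.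
    move=> j _; apply: big1 => s /andP[/imsetP[s2 _ ->]].
    by case/imsetP.
  apply: eq_bigr => i _; rewrite big_mkcondr big_imset /=; last first.
    by move=> a b _ _ e; rewrite -(preimr a) e preimr.
  rewrite [RHS]big_mkcondr; apply: eq_bigr => s _.
  by rewrite preimr mem_imset //; exact: inr_inj.
exists f; split; last by case=> r; rewrite ?loadl ?loadr ?ld1 ?ld2.
split.
  case=> h /=; split=> [s /imsetP[s1 hs1 ->]|].
  - by rewrite preiml; apply: (fea1 h).1.
  - rewrite big_imset /=; last by move=> a b _ _ e; rewrite -(preiml a) e preiml.
    by under eq_bigr => s _ do rewrite preiml; rewrite (fea1 h).2.
  - by rewrite preimr; apply: (fea2 h).1.
  - rewrite big_imset /=; last by move=> a b _ _ e; rewrite -(preimr a) e preimr.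
    by under eq_bigr => s _ do rewrite preimr; rewrite (fea2 h).2.
case=> h /=.
  have [lam hlam] := war1 h; exists lam => s /imsetP[s1 hs1 ->].
  rewrite preiml; have -> : strat_cost f (inl @: s1) = strat_cost f1 s1.
    rewrite /strat_cost big_imset /=; last by move=> a b _ _ [].
    by apply: eq_bigr => r _; rewrite loadl.
  exact: hlam.
have [lam hlam] := war2 h; exists lam => s /imsetP[s2 hs2 ->].
rewrite preimr; have -> : strat_cost f (inr @: s2) = strat_cost f2 s2.
  rewrite /strat_cost big_imset /=; last by move=> a b _ _ [].
  by apply: eq_bigr => r _; rewrite loadr.
exact: hlam.
Qed.

End Union.

(** * Products of games *)

Section Product.
Variables (R : realType) (G1 G2 : cgame R).

Lemma prod_game_MES : has_MES G1 -> has_MES G2 -> has_MES (prod_game G1 G2).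
Proof.
move=> [x1 [eq1 mon1]] [x2 [eq2 mon2]].
pose mu1 (mu : com (prod_game G1 G2) -> R) i := \sum_j mu (i, j).
pose mu2 (mu : com (prod_game G1 G2) -> R) j := \sum_i mu (i, j).
exists (fun mu r => match r with inl r1 => x1 (mu1 mu) r1
                               | inr r2 => x2 (mu2 mu) r2 end).
have mu1_ge0 mu : (forall h, 0 <= mu h) -> forall i, 0 <= mu1 mu i.
  by move=> mu0 i; apply: sumr_ge0.
have mu2_ge0 mu : (forall h, 0 <= mu h) -> forall j, 0 <= mu2 mu j.
  by move=> mu0 j; apply: sumr_ge0.
split=> [mu mu0|]; last first.
  move=> r [i j] mu mu' mu0 mu'0 eqmu lemu.
  (* Raising the entry [(i, j)] changes only the marginals at [i] and at [j], so monotonicity in one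
     component suffices in each factor. *)
  have le_mu k : mu k <= mu' k.
    by have [->//|/eqmu ->] := eqVneq k (i, j).
  case: r => r.
    apply: (mon1 r i) => //; try exact: mu1_ge0.
      move=> k ki; apply: eq_bigr => l _; apply: eqmu.
      by apply: contra ki => /eqP[-> _].
    exact: ler_sum.
  apply: (mon2 r j) => //; try exact: mu2_ge0.
    move=> k ki; apply: eq_bigr => l _; apply: eqmu.
    by apply: contra ki => /eqP[_ ->].
  exact: ler_sum.
have [f1 [[fea1 war1] ld1]] := eq1 _ (mu1_ge0 _ mu0).
have [f2 [[fea2 war2] ld2]] := eq2 _ (mu2_ge0 _ mu0).
set m1 := mu1 mu in fea1 war1 ld1 *; set m2 := mu2 mu in fea2 war2 ld2 *.
(* A zero marginal forces zero demands and zero factor flows, which makes the convention [x / 0 = 0]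
   harmless in [f] below. *)
have m1_eq0 i j : m1 i = 0 -> mu (i, j) = 0.
  by move=> h; apply: (psumr_eq0P _ h).
have m2_eq0 i j : m2 j = 0 -> mu (i, j) = 0.
  by move=> h; apply: (psumr_eq0P _ h).
have f1_eq0 i s : s \in strat G1 i -> m1 i = 0 -> f1 i s = 0.
  by rewrite -(fea1 i).2 => hs h; apply: (psumr_eq0P (fea1 i).1 h).
have f2_eq0 j s : s \in strat G2 j -> m2 j = 0 -> f2 j s = 0.
  by rewrite -(fea2 j).2 => hs h; apply: (psumr_eq0P (fea2 j).1 h).
pose f (h : com (prod_game G1 G2)) (s : {set res (prod_game G1 G2)}) :=
  mu h / (m1 h.1 * m2 h.2) * (f1 h.1 (inl @^-1: s) * f2 h.2 (inr @^-1: s)).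
have fE h (s1 : {set res G1}) (s2 : {set res G2}) : f h (inl @: s1 :|: inr @: s2) =
    mu h / (m1 h.1 * m2 h.2) * (f1 h.1 s1 * f2 h.2 s2).
  by rewrite /f preim_inl_setU preim_inr_setU.
(* Summing out the second strategy leaves [f1] with weight [mu (i, j) / m1 i]; over [j] these
   weights add up to 1 unless [m1 i = 0]. *)
have sum2 i j (s1 : {set res G1}) : \sum_(s2 in strat G2 j) f (i, j) (inl @: s1 :|: inr @: s2) =
    mu (i, j) / m1 i * f1 i s1.
  under eq_bigr => s2 _ do rewrite fE /=.
  rewrite -mulr_sumr -mulr_sumr (fea2 j).2.
  have [/m2_eq0->|m0] := eqVneq (m2 j) 0; first by rewrite !mul0r.
  by rewrite [f1 i s1 * _]mulrC mulrA invfM [mu _ * _]mulrA divfK.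
have sum1 i j (s2 : {set res G2}) : \sum_(s1 in strat G1 i) f (i, j) (inl @: s1 :|: inr @: s2) =
    mu (i, j) / m2 j * f2 j s2.
  under eq_bigr => s1 _ do rewrite fE /=.
  rewrite -mulr_sumr -mulr_suml (fea1 i).2.
  have [/m1_eq0->|m0] := eqVneq (m1 i) 0; first by rewrite !mul0r.
  rewrite mulrA; congr (_ * _).
  by rewrite invfM [_^-1 * _]mulrC mulrA divfK.
have loadl r : load f (inl r) = load f1 r.
  rewrite /load; transitivity (\sum_i \sum_j
      \sum_(s in strat (prod_game G1 G2) (i, j) | inl r \in s) f (i, j) s).
    by rewrite pair_bigA; apply: eq_bigr => -[i j] _.
  apply: eq_bigr => i _.
  transitivity (\sum_j \sum_(s1 in strat G1 i | r \in s1) mu (i, j) / m1 i * f1 i s1).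
    apply: eq_bigr => j _; rewrite sum_imset2_setU [RHS]big_mkcondr.
    apply: eq_bigr => s1 _.
    under eq_bigl => s2 do rewrite mem_inl_setU.
    case: ifP => hr; last by apply: big1 => s2; rewrite andbF.
    by rewrite -sum2; apply: eq_bigl => s2; rewrite andbT.
  rewrite exchange_big; apply: eq_bigr => s1 /andP[hs1 _].
  rewrite -mulr_suml -mulr_suml -/(m1 i).
  have [h|h] := eqVneq (m1 i) 0; first by rewrite f1_eq0 ?mulr0.
  by rewrite divff ?mul1r.
have loadr r : load f (inr r) = load f2 r.
  rewrite /load; transitivity (\sum_i \sum_j
      \sum_(s in strat (prod_game G1 G2) (i, j) | inr r \in s) f (i, j) s).
    by rewrite pair_bigA; apply: eq_bigr => -[i j] _.
  rewrite exchange_big /=.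
  apply: eq_bigr => j _.
  transitivity (\sum_i \sum_(s2 in strat G2 j | r \in s2) mu (i, j) / m2 j * f2 j s2).
    apply: eq_bigr => i _; rewrite sum_imset2_setU.
    under eq_bigr => s1 _ do under eq_bigl => s2 do rewrite mem_inr_setU.
    by rewrite exchange_big; apply: eq_bigr => s2 _; exact: sum1.
  rewrite exchange_big; apply: eq_bigr => s2 /andP[hs2 _].
  rewrite -mulr_suml -mulr_suml -/(m2 j).
  have [h|h] := eqVneq (m2 j) 0; first by rewrite f2_eq0 ?mulr0.
  by rewrite divff ?mul1r.
have coef_ge0 h : 0 <= mu h / (m1 h.1 * m2 h.2).
  by rewrite divr_ge0 ?mulr_ge0 ?mu1_ge0 ?mu2_ge0.
exists f; split; last by case=> r; rewrite ?loadl ?loadr ?ld1 ?ld2.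
split.
  case=> i j; split.
    move=> s /imset2P[s1 s2 hs1 hs2 ->]; rewrite fE.
    exact: mulr_ge0 (coef_ge0 (i, j))
      (mulr_ge0 ((fea1 i).1 _ hs1) ((fea2 j).1 _ hs2)).
  have := sum_imset2_setU (strat G1 i) (strat G2 j) predT (f (i, j)).
  under eq_bigl => s do rewrite andbT.
  move=> /= ->.
  rewrite (eq_bigr (fun s1 => mu (i, j) / m1 i * f1 i s1)); last first.
    by move=> s1 _; rewrite -sum2; apply: eq_bigl => s2; rewrite andbT.
  rewrite -mulr_sumr (fea1 i).2.
  have [h|h] := eqVneq (m1 i) 0; first by rewrite m1_eq0 // !mul0r.
  by rewrite divfK.
case=> i j; have [lam1 hl1] := war1 i; have [lam2 hl2] := war2 j.
exists (lam1 + lam2) => s /imset2P[s1 s2 hs1 hs2 ->]; rewrite fE /=.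
have -> : strat_cost f (inl @: s1 :|: inr @: s2) = strat_cost f1 s1 + strat_cost f2 s2.
  rewrite /strat_cost sum_setU_inl_inr /=; congr (_ + _); apply: eq_bigr => r _.
    by rewrite loadl.
  by rewrite loadr.
have [c1 l1] := hl1 _ hs1; have [c2 l2] := hl2 _ hs2.
split; last exact: lerD.
(* Positive product flow forces both factor flows to be positive, so both halves of the strategy
   have equilibrium cost. *)
move=> fgt0; have f1_ge0 := (fea1 i).1 _ hs1; have f2_ge0 := (fea2 j).1 _ hs2.
rewrite c1 ?c2 // lt_neqAle ?f1_ge0 ?f2_ge0 andbT eq_sym;
  by apply: contraTneq fgt0 => ->; rewrite ?mulr0 ?mul0r ?mulr0 ltxx.
Qed.

End Product.

(** * Transport of equilibria along a renaming of resources and commodities *)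

Lemma game_iso_MES (R : realType) (G G' : cgame R) :
  game_iso G G' -> has_MES G -> has_MES G'.
Proof.
move=> [fR [fH [[gR fRK gRK] [[gH fHK gHK] [stratE costE]]]]] [x [eqx mon]].
exists (fun mu r => x (mu \o fH) (gR r)); split=> [mu mu0|]; last first.
  move=> r h mu mu' mu0 mu'0 eqmu lemu; apply: (mon _ (gH h)) => //=.
    by move=> h' hh'; apply: eqmu; apply: contra hh' => /eqP <-; rewrite fHK.
  by rewrite gHK.
have [f [[fea war] ld]] := eqx (mu \o fH) (fun=> mu0 _).
have fR_inj := can_inj fRK.
pose f' h (s : {set res G'}) := f (gH h) (fR @^-1: s).
have preimR (s : {set res G}) : fR @^-1: (fR @: s) = s.
  by apply/setP => r; rewrite inE mem_imset.
have stratE' h : strat G' h = [set fR @: s | s : {set res G} in strat G (gH h)].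
  by rewrite -stratE gHK.
have imR_inj (s t : {set res G}) : fR @: s = fR @: t -> s = t.
  by move=> e; rewrite -(preimR s) e preimR.
have loadE r : load f' (fR r) = load f r.
  rewrite /load (reindex fH) /=; last by exists gH => h _.
  apply: eq_bigr => h _; rewrite big_mkcondr stratE big_imset /=; last first.
    by move=> a b _ _; apply: imR_inj.
  rewrite [RHS]big_mkcondr; apply: eq_bigr => s _.
  by rewrite mem_imset // /f' fHK preimR.
exists f'; split; last by move=> r; rewrite -{1}(gRK r) loadE ld.
split.
  move=> h; split.
    by move=> s; rewrite stratE' => /imsetP[s1 hs1 ->]; rewrite /f' preimR; apply: (fea _).1.
  rewrite stratE' big_imset /=; last by move=> a b _ _; apply: imR_inj.
  under eq_bigr => s _ do rewrite /f' preimR.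
  by rewrite (fea _).2 /= gHK.
move=> h; have [lam hlam] := war (gH h); exists lam => s.
rewrite stratE' => /imsetP[s1 hs1 ->]; rewrite /f' preimR.
have -> : strat_cost f' (fR @: s1) = strat_cost f s1.
  rewrite /strat_cost big_imset /=; last by move=> a b _ _; apply: fR_inj.
  by apply: eq_bigr => r _; rewrite costE loadE.
exact: hlam.
Qed.

(** * Pure equilibria of atomic singleton congestion games *)

Section AtomicNash.
Variables (R : realDomainType) (P Rs : finType) (S : P -> {set Rs}).
(* [w r k]: cost of [r] for a player who shares it with [k] others. *)
Variable w : Rs -> nat -> R.

Definition users (a : {ffun P -> Rs}) r := #|[set p | a p == r]|.

(** The count at [a p] includes [p], hence the predecessor; the count at the alternative [r] does
    not. *)
Lemma atomic_nash :
  (forall p, S p != set0) ->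
  exists a : {ffun P -> Rs}, (forall p, a p \in S p) /\
    forall p r, r \in S p -> r != a p ->
      w (a p) (users a (a p)).-1 <= w r (users a r).
Proof.
move=> S0.
pose a0 : {ffun P -> Rs} := [ffun p => xchoose (set0Pn _ (S0 p))].
have a0P : [forall p, a0 p \in S p].
  by apply/forallP => p; rewrite ffunE; exact: xchooseP.
(* Rosenthal's potential: its change under a unilateral deviation is the
   change of the deviator's cost. *)
pose Phi a := \sum_r \sum_(i < users a r) w r i.
case: (@Order.TotalTheory.arg_minP _ _ _ a0
  (fun a : {ffun P -> Rs} => [forall p, a p \in S p]) Phi a0P)
  => a /forallP aS amin.
exists a; split=> // p r rS rap.
pose a' : {ffun P -> Rs} := [ffun q => if q == p then r else a q].
have /amin : [forall q, a' q \in S q].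
  by apply/forallP => q; rewrite ffunE; case: eqP => [->|].
have ur : users a' r = (users a r).+1.
  rewrite /users (cardsD1 p) inE ffunE !eqxx; congr _.+1; apply: eq_card => q.
  by rewrite !inE ffunE; case: (eqVneq q p) => // ->; rewrite eq_sym (negbTE rap).
have up : users a (a p) = (users a' (a p)).+1.
  rewrite /users (cardsD1 p) inE !eqxx; congr _.+1; apply: eq_card => q.
  by rewrite !inE ffunE; case: (eqVneq q p) => // ->; rewrite (negbTE rap).
have uo s : s != r -> s != a p -> users a' s = users a s.
  move=> sr sap; apply: eq_card => q; rewrite !inE ffunE.
  by case: (eqVneq q p) => // ->; rewrite !(eq_sym _ s) (negbTE sr) (negbTE sap).
(* Only the terms of [r] and [a p] differ: [a] has one extra summand at [a p], the current cost of
   [p], and [a'] one at [r], the cost after deviating. *)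
rewrite /Phi (bigD1 r) //= [X in _ <= X](bigD1 r) //=.
rewrite (bigD1 (a p)) 1?eq_sym //= [X in _ <= _ + X](bigD1 (a p)) 1?eq_sym //=.
rewrite ur up !big_ord_recr /=.
have -> : \sum_(s | (s != r) && (s != a p)) \sum_(i < users a' s) w s i =
    \sum_(s | (s != r) && (s != a p)) \sum_(i < users a s) w s i.
  by apply: eq_bigr => s /andP[sr sap]; rewrite uo.
by move=> ?; lra.
Qed.

End AtomicNash.

(** * Limits along an ultrafilter *)

Section UltraLimit.
Variable R : realType.
Local Open Scope classical_set_scope.

(** Compactness gives a cluster point, and a cluster point of an ultrafilter is a limit: a
    neighbourhood outside the filter would have its complement in it, which it fails to meet. *)
Lemma ultra_segment_cvg (T : Type) (U : set_system T) (a b : R) (u : T -> R) :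
  UltraFilter U -> (forall n, a <= u n <= b) -> exists l : R, u @ U --> l.
Proof.
move=> UU uab.
have FF : ProperFilter (u @ U) by exact: fmap_proper_filter.
have Fab : U (u @^-1` `[a, b]%classic).
  by apply: filterE => n; rewrite /= in_itv /= uab.
have [l [_ cl]] := @segment_compact R a b _ FF Fab.
exists l => N lN.
have [//|UN] := in_ultra_setVsetC (u @^-1` N) UU.
by have [x [? ?]] := cl (~` N) N UN lN.
Qed.

Lemma cvg_sum_fin (T : Type) (U : set_system T) (I : finType)
    (F : I -> T -> R) (l : I -> R) :
  Filter U -> (forall i, F i n @[n --> U] --> l i) ->
  \sum_i F i n @[n --> U] --> \sum_i l i.
Proof.
by move=> FU Fl; apply: cvg_big => // -[x y]; exact: (@add_continuous R).
Qed.

End UltraLimit.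

(** * Flows and equilibria when strategies are single resources *)

Section SingletonFlow.
Variables (R : realType) (H Rs : finType) (S : H -> {set Rs}).
Implicit Types (mu : H -> R) (g : H -> Rs -> R) (c : Rs -> R -> R).

(** Flows are indexed by resources and vanish off [S h], so that sums run over all resources. *)
Definition sflow mu g :=
  [/\ forall h r, 0 <= g h r, forall h r, r \notin S h -> g h r = 0
    & forall h, \sum_r g h r = mu h].

Definition sload g r := \sum_h g h r.

(** Wardrop's condition without the multiplier: a used resource costs no more than any available
    one. *)
Definition sequilibrium c mu g :=
  sflow mu g /\ forall h r r', r' \in S h -> 0 < g h r ->
    c r (sload g r) <= c r' (sload g r').

Lemma sflow_support mu g h r : sflow mu g -> 0 < g h r -> r \in S h.
Proof.
by case=> _ g0 _ gr; apply: contraLR gr => /g0 ->; rewrite ltxx.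
Qed.

Lemma sflow_le mu g h r : sflow mu g -> g h r <= mu h.
Proof. by case=> g0 _ <-; rewrite (bigD1 r) //= lerDl sumr_ge0. Qed.

Lemma sload_le mu g r : sflow mu g -> sload g r <= \sum_h mu h.
Proof. by move=> gmu; apply: ler_sum => h _; exact: sflow_le gmu. Qed.

Lemma sload_ge0 mu g r : sflow mu g -> 0 <= sload g r.
Proof. by case=> g0 _ _; apply: sumr_ge0. Qed.

(* If [A] is the set of resources whose load is larger for the smaller demand,
   some commodity moves flow out of [A]; comparing both equilibria along that
   move contradicts strict monotonicity. *)
Lemma sequilibrium_load_mono c mu mu' g g' :
  (forall r x y, x < y -> c r x < c r y) ->
  (forall h, mu h <= mu' h) ->
  sequilibrium c mu g -> sequilibrium c mu' g' ->
  forall r, sload g r <= sload g' r.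
Proof.
move=> c_lt lemu [gmu eqg] [gmu' eqg'] r0; rewrite leNgt; apply/negP => r0A.
pose A := [set r | sload g' r < sload g r].
have : \sum_(r in A) sload g' r < \sum_(r in A) sload g r.
  rewrite (bigD1 r0) ?inE //= [X in _ < X](bigD1 r0) ?inE //=.
  rewrite ltr_leD //; apply: ler_sum => r /andP[+ _]; rewrite inE.
  exact: ltW.
rewrite /sload exchange_big [X in _ < X]exchange_big /=.
have [/existsP[h hA]|nA] :=
    boolP [exists h, \sum_(r in A) g' h r < \sum_(r in A) g h r]; last first.
  rewrite ltNge ler_sum // => h _; rewrite leNgt.
  by move/existsPn: nA; apply.
move=> _.
have [g0 _ gsum] := gmu; have [g'0 _ g'sum] := gmu'.
(* The demand of [h] is at least as large under [mu'], so its deficit inside [A] becomes a surplus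
   outside. *)
have hA' : \sum_(r | r \notin A) g h r < \sum_(r | r \notin A) g' h r.
  have := lemu h; rewrite -gsum -g'sum (bigID (mem A)) /= [X in _ <= X](bigID (mem A)) /=.
  by move: hA; lra.
have [r rA gr] : exists2 r, r \in A & 0 < g h r.
  have [/exists_inP[r rA gr]|/exists_inPn n] := boolP [exists r in A, 0 < g h r].
    by exists r.
  move: hA; rewrite ltNge (le_trans (_ : _ <= 0)) ?sumr_ge0 // sumr_le0 // => r rA.
  by rewrite leNgt n.
have [r' r'A gr'] : exists2 r, r \notin A & 0 < g' h r.
  have [/exists_inP[r' rA' gr']|/exists_inPn n] := boolP [exists r in [predC A], 0 < g' h r].
    by exists r'.
  move: hA'; rewrite ltNge (le_trans (_ : _ <= 0)) ?sumr_ge0 // sumr_le0 // => r' rA'.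
  by rewrite leNgt n.
have c_le s x y : x <= y -> c s x <= c s y.
  by rewrite le_eqVlt => /orP[/eqP->//|/(c_lt s)/ltW].
(* With loads [x] of [g] and [x'] of [g'], the contradictory cycle is [c r (x r) <= c r' (x r') <= c
   r' (x' r') <= c r (x' r) < c r (x r)]. *)
have h1 := eqg h r r' (sflow_support gmu' gr') gr.
have h2 := eqg' h r' r (sflow_support gmu gr) gr'.
have h3 : c r' (sload g r') <= c r' (sload g' r').
  by apply: c_le; move: r'A; rewrite inE -leNgt.
have h4 : c r (sload g' r) < c r (sload g r) by apply: c_lt; move: rA; rewrite inE.
by move: (le_lt_trans (le_trans h1 (le_trans h3 h2)) h4); rewrite ltxx.
Qed.

Local Open Scope classical_set_scope.

(** The slack [b n] occurs twice to cover both uses: inside the cost it absorbs the weight of an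
    atomic player, outside it the perturbation of the costs. The bound [B] keeps the flows in a
    compact segment. *)
Lemma sequilibrium_ultralimit (U : set_system nat) c mu (mu_ : nat -> H -> R)
    (g_ : nat -> H -> Rs -> R) (b : nat -> R) (B : R) :
  UltraFilter U ->
  (forall r, continuous (c r)) ->
  (forall h, mu_ n h @[n --> U] --> mu h) ->
  (forall n h, mu_ n h <= B) ->
  b @ U --> 0 ->
  (forall n, sflow (mu_ n) (g_ n)) ->
  (forall n h r r', r' \in S h -> 0 < g_ n h r ->
     c r (sload (g_ n) r) <= c r' (sload (g_ n) r' + b n) + b n) ->
  exists g, sequilibrium c mu g /\
    forall r, sload (g_ n) r @[n --> U] --> sload g r.
Proof.
move=> UU c_cont mu_cvg mu_B b0 gmu g_eq.
have /choice[g gP] (p : H * Rs) : exists l : R, g_ n p.1 p.2 @[n --> U] --> l.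
  apply: (@ultra_segment_cvg _ _ _ 0 B) => n; have [g0 _ _] := gmu n.
  by rewrite g0 (le_trans (sflow_le _ _ (gmu n))).
pose f h r := g (h, r).
have fP h r : g_ n h r @[n --> U] --> f h r by exact: (gP (h, r)).
have loadP r : sload (g_ n) r @[n --> U] --> sload f r.
  by apply: cvg_sum_fin => h; exact: fP.
exists f; split=> //; split; first split.
- move=> h r; apply: (cvgr_to_ge (fP h r)); apply: filterE => n.
  by have [g0 _ _] := gmu n.
- move=> h r rS; apply: (cvg_unique _ (fP h r)) => //.
  rewrite (_ : (fun n => _) = fun=> 0); first exact: cvg_cst.
  by apply: funext => n; have [_ + _] := gmu n; apply.
- move=> h; apply: (cvg_unique _ _ (mu_cvg h)) => //.
  rewrite (_ : (fun n => mu_ n h) = fun n => \sum_r g_ n h r).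
    by apply: cvg_sum_fin => r; exact: fP.
  by apply: funext => n; have [_ _ ->] := gmu n.
move=> h r r' r'S fr.
have c1 : c r (sload (g_ n) r) @[n --> U] --> c r (sload f r).
  by apply: continuous_cvg (loadP r); exact: c_cont.
have c2 : c r' (sload (g_ n) r' + b n) + b n @[n --> U] --> c r' (sload f r').
  rewrite -[X in _ --> X]addr0; apply: (cvgD _ b0).
  apply: continuous_cvg; first exact: c_cont.
  by rewrite -[X in _ --> X]addr0; exact: cvgD (loadP r') b0.
apply: (ler_cvg_to c1 c2).
(* Flow that is positive in the limit is positive for [U]-almost all [n], where the approximate
   condition applies. *)
have : \forall n \near U, 0 < g_ n h r by exact: (cvgr_gt _ (fP h r)).
by apply: filterS => n; exact: g_eq.
Qed.

(** Commodity [h] is split into [m h] players of weight [d]. A player who moves to [r'] adds [d] to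
    its load, which is the slack in the conclusion. *)
Lemma atomic_sflow c (d : R) (m : H -> nat) :
  0 < d -> (forall h, S h != finset.set0) ->
  (forall r x y, x <= y -> c r x <= c r y) ->
  exists g, sflow (fun h => (m h)%:R * d) g /\
    forall h r r', r' \in S h -> 0 < g h r ->
      c r (sload g r) <= c r' (sload g r' + d).
Proof.
move=> d0 S0 c_le.
pose P : finType := {h : H & 'I_(m h)}.
pose atom h (i : 'I_(m h)) : P := Tagged (fun h => 'I_(m h)) i.
(* The player itself is counted on top of the [k] others. *)
pose w r k := c r (k.+1%:R * d).
have [a [aS aN]] := @atomic_nash R P Rs (fun p => S (tag p)) w (fun p => S0 _).
pose g h r := (\sum_(i < m h) (a (atom _ i) == r))%:R * d.
have gload r : sload g r = (users a r)%:R * d.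
  rewrite /sload -mulr_suml -natr_sum sig_big_dep /=; congr (_%:R * _).
  rewrite /users -sum1dep_card [RHS]big_mkcond /=.
  by apply: eq_bigr => -[h i] _ /=; case: eqP.
exists g; split; first split.
- by move=> h r; rewrite mulr_ge0 // ltW.
- move=> h r rS; rewrite /g big1 ?mul0r // => i _.
  by case: eqP => // e; have := aS (atom _ i); rewrite /= e (negbTE rS).
- move=> h; rewrite -mulr_suml -natr_sum exchange_big /=; congr (_%:R * _).
  rewrite (eq_bigr (fun=> 1%N)) ?sum1_card ?card_ord // => i _.
  rewrite (bigD1 (a (atom _ i))) //= eqxx big1 // => r.
  by rewrite eq_sym => /negbTE ->.
move=> h r r' r'S; rewrite /g.
have [->|] := eqVneq (\sum_(i < m h) (a (atom _ i) == r))%N 0%N.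
  by rewrite mul0r ltxx.
rewrite sum_nat_eq0 => /forallPn[i]; rewrite /= eqb0 negbK => /eqP ar _.
(* The atomic equilibrium only compares with other resources; for [r' = r] monotonicity of the cost
   is enough. *)
have [->|r'r] := eqVneq r' r; first by apply: c_le; rewrite lerDl ltW.
have := aN (atom _ i) r'; rewrite /= ar => /(_ r'S r'r).
have u0 : (0 < users a r)%N.
  by rewrite /users card_gt0; apply/set0Pn; exists (atom _ i); rewrite inE ar.
by rewrite !gload /w prednK // -natr1 mulrDl mul1r.
Qed.

Lemma sequilibrium_exists c mu :
  (forall h, S h != finset.set0) -> (forall h, 0 <= mu h) ->
  (forall r, continuous (c r)) ->
  (forall r x y, x <= y -> c r x <= c r y) ->
  exists g, sequilibrium c mu g.
Proof.
move=> S0 mu0 c_cont c_le.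
(* [U] refines the filter of eventual events, so ordinary limits in [n] remain limits along [U]. *)
have [U [UU ooU]] := ultraFilterLemma (@eventually_filter).
(* Demands are rounded down to multiples of [1 / (n + 1)], with an error that vanishes in the
   limit. *)
pose m n h := Num.truncn (mu h * n.+1%:R).
pose mu_ n h := (m n h)%:R * @harmonic R n.
have /choice[g_ gP] n := @atomic_sflow c (harmonic n) (m n) (harmonic_gt0 n) S0 c_le.
have b0 : @harmonic R @ U --> 0 by apply: cvg_trans (@cvg_harmonic R) => A /ooU.
have mu_itv n h : mu h - harmonic n <= mu_ n h <= mu h.
  have /andP[l u] := truncn_itv (mulr_ge0 (mu0 h) (ler0n R n.+1)).
  rewrite /mu_ /harmonic /=; apply/andP; split; last by rewrite ler_pdivrMr.
  by rewrite lerBlDr -[X in _ + X]mul1r -mulrDl ler_pdivlMr // natr1 ltW.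
have mu_cvg h : mu_ n h @[n --> U] --> mu h.
  apply: (@squeeze_cvgr _ _ _ _ (fun n => mu h - harmonic n) (fun=> mu h)).
  - by apply: filterE => n; exact: mu_itv.
  - by rewrite -[X in _ --> X]subr0; apply: cvgB => //; exact: cvg_cst.
  - exact: cvg_cst.
have mu_le n h : mu_ n h <= \sum_h mu h.
  have /andP[_ /le_trans] := mu_itv n h; apply.
  by rewrite (bigD1 h) //= lerDl sumr_ge0.
have g_eq n h r r' : r' \in S h -> 0 < g_ n h r ->
    c r (sload (g_ n) r) <= c r' (sload (g_ n) r' + harmonic n) + harmonic n.
  move=> r'S gr; apply: le_trans ((gP n).2 h r r' r'S gr) _.
  by rewrite lerDl ltW // harmonic_gt0.
have [g [gE _]] := sequilibrium_ultralimit UU c_cont mu_cvg mu_le b0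
  (fun n => (gP n).1) g_eq.
by exists g.
Qed.

(** [U] is fixed before the demand, so loads for two demands are limits along the same filter and
    their order at each [n] survives. *)
Lemma sequilibrium_selection c :
  (forall h, S h != finset.set0) ->
  (forall r, continuous (c r)) ->
  (forall r x y, x <= y -> c r x <= c r y) ->
  exists x : (H -> R) -> Rs -> R,
    (forall mu, (forall h, 0 <= mu h) ->
       exists g, sequilibrium c mu g /\ forall r, sload g r = x mu r) /\
    (forall mu mu', (forall h, 0 <= mu h) -> (forall h, mu h <= mu' h) ->
       forall r, x mu r <= x mu' r).
Proof.
move=> S0 c_cont c_le.
have [U [UU ooU]] := ultraFilterLemma (@eventually_filter).
have b0 : @harmonic R @ U --> 0 by apply: cvg_trans (@cvg_harmonic R) => A /ooU.
(* The slope makes the cost strictly increasing, hence loads monotone; it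
   vanishes as n grows. *)
pose c_ n r x := c r x + x * @harmonic R n.
have c_lt n r x y : x < y -> c_ n r x < c_ n r y.
  by move=> xy; rewrite ler_ltD ?c_le ?ltW // ltr_pM2r ?harmonic_gt0.
have c_c n r : continuous (c_ n r).
  move=> x; apply: cvgD; first exact: c_cont.
  by apply: cvgM; [exact: cvg_id|exact: cvg_cst].
have /choice[g_ gP] (p : (H -> R) * nat) : exists g, (forall h, 0 <= p.1 h) ->
    sequilibrium (c_ p.2) p.1 g.
  (* The zero flow is a dummy value for demands with a negative entry. *)
  have [mu0|nmu] := pselect (forall h, 0 <= p.1 h); last by exists (fun _ _ => 0).
  have [|g gE] := sequilibrium_exists S0 mu0 (c_c p.2); last by exists g.
  by move=> r x y; rewrite le_eqVlt => /orP[/eqP->//|/(c_lt p.2 r)/ltW].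
have limP mu : (forall h, 0 <= mu h) -> exists g, sequilibrium c mu g /\
    forall r, sload (g_ (mu, n)) r @[n --> U] --> sload g r.
  move=> mu0; pose M := \sum_h mu h; have M0 : 0 <= M by exact: sumr_ge0.
  have E n : sequilibrium (c_ n) mu (g_ (mu, n)) := gP (mu, n) mu0.
  (* No load exceeds the total demand [M], so the added slope changes a cost by at most
     [M / (n + 1)]. *)
  apply: (@sequilibrium_ultralimit U c mu (fun=> mu) (fun n => g_ (mu, n))
    (fun n => M * harmonic n) M) => //.
  - by move=> h; exact: cvg_cst.
  - by move=> n h; rewrite /M (bigD1 h) //= lerDl sumr_ge0.
  - by rewrite -[X in _ --> X](mulr0 M); apply: cvgM => //; exact: cvg_cst.
  - by move=> n; exact: (E n).1.
  move=> n h r r' r'S gr; have [gF /(_ h r r' r'S gr)] := E n; rewrite /c_.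
  have hn : 0 < harmonic n :> R := harmonic_gt0 n.
  have h1 : 0 <= sload (g_ (mu, n)) r * harmonic n.
    by rewrite mulr_ge0 ?(ltW hn) ?(sload_ge0 _ gF).
  have h2 : sload (g_ (mu, n)) r' * harmonic n <= M * harmonic n.
    by rewrite ler_pM2r // (sload_le _ gF).
  have h3 : c r' (sload (g_ (mu, n)) r') <=
      c r' (sload (g_ (mu, n)) r' + M * harmonic n).
    by apply: c_le; rewrite lerDl mulr_ge0 // ltW.
  by move: h1 h2 h3; lra.
have /choice[g gE] (mu : H -> R) : exists g, (forall h, 0 <= mu h) ->
    sequilibrium c mu g /\
    forall r, sload (g_ (mu, n)) r @[n --> U] --> sload g r.
  have [/limP[g gE]|nmu] := pselect (forall h, 0 <= mu h); first by exists g.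
  by exists (fun _ _ => 0).
exists (fun mu => sload (g mu)); split=> [mu mu0|mu mu' mu0 lemu r].
  by exists (g mu); split=> //; exact: (gE mu mu0).1.
have mu'0 h : 0 <= mu' h by exact: le_trans (mu0 h) (lemu h).
apply: (ler_cvg_to ((gE mu mu0).2 r) ((gE mu' mu'0).2 r)).
apply: filterE => n; apply: (sequilibrium_load_mono (c_lt n) lemu).
  exact: gP (mu, n) mu0.
exact: gP (mu', n) mu'0.
Qed.

End SingletonFlow.

(** * From singleton flows to singleton games *)

Section SingletonGame.
Variable R : realType.
Local Open Scope classical_set_scope.

(** Costs are controlled only on the half-line, whereas the results on singleton flows ask for
    continuity on the whole line; truncation at 0 extends the cost without changing it at actual
    loads. *)
Lemma continuous_max0 (c : R -> R) :
  {within [set x : R | 0 <= x]%classic, continuous c}%classic ->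
  continuous (fun x : R => c (Num.max 0 x)).
Proof.
move=> /subspace_continuousP c_cont x.
have m0 y : 0 <= Num.max 0 y :> R by rewrite le_max lexx.
apply: (@cvg_comp _ _ _ (fun y => Num.max 0 y) c _ _ _ _ (c_cont _ (m0 x))).
move=> A /= wA.
have maxc : continuous (fun y : R => Num.max 0 y).
  by move=> y; apply: continuous_max; [exact: cvg_cst|exact: cvg_id].
have wAx : \forall y \near x, 0 <= Num.max 0 y -> A (Num.max 0 y) := maxc x _ wA.
by rewrite /fmap /=; apply: filterS wAx => y /(_ (m0 y)).
Qed.

Lemma singleton_game_MES (G : cgame R) :
  wf_game G -> singleton_game G -> has_MES G.
Proof.
move=> [strat0 costP] single.
pose S h := [set r | [set r] \in strat G h]%SET.
have stratE h : strat G h = [set [set r] | r in S h]%SET.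
  apply/setP => s; apply/idP/imsetP => [sG|[r + ->]]; last by rewrite inE.
  by have [r e] := single _ _ sG; exists r => //; rewrite inE -e.
have S0 h : S h != finset.set0.
  by have := strat0 h; rewrite stratE; apply: contraNneq => ->; rewrite imset0.
pose c r x := cost G r (Num.max 0 x).
have [x [xP xmon]] : exists x : (com G -> R) -> res G -> R,
    (forall mu, (forall h, 0 <= mu h) ->
       exists g, sequilibrium S c mu g /\ forall r, sload g r = x mu r) /\
    (forall mu mu', (forall h, 0 <= mu h) -> (forall h, mu h <= mu' h) ->
       forall r, x mu r <= x mu' r).
  apply: sequilibrium_selection => // r; have [c0 [c_le c_cont]] := costP r.
    exact: continuous_max0.
  move=> y z yz; apply: c_le; first by rewrite le_max lexx.
  by rewrite ge_max le_max lexx /= le_max yz orbT.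
exists x; split=> [mu mu0|r h mu mu' mu0 _ eqmu lemu]; last first.
  by apply: xmon => // h'; have [->//|/eqmu ->] := eqVneq h' h.
have [g [[gF gE] gx]] := xP mu mu0; have [g0 gS gmu] := gF.
(* The sum extends [g] to all sets and gives back [g h r] on [[set r]]. *)
pose f h (s : {set res G}) := \sum_(r in s) g h r.
have f1 h r : f h [set r]%SET = g h r by rewrite /f big_set1.
have loadE r : load f r = sload g r.
  apply: eq_bigr => h _; rewrite big_mkcondr stratE big_imset /=; last first.
    by move=> ? ? _ _; exact: set1_inj.
  under eq_bigr => r' _ do rewrite f1 inE.
  rewrite -big_mkcondr /=.
  have [rS|rS] := boolP (r \in S h).
    by apply: big_pred1 => r'; rewrite /= (eq_sym r) andbC; case: eqP => // ->.
  by rewrite gS // big1 // => r' /andP[r'S /eqP e]; rewrite -e (negbTE rS) in r'S.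
exists f; split; last by move=> r; rewrite loadE.
split.
  move=> h; split=> [s _|]; first exact: sumr_ge0.
  rewrite stratE big_imset /=; last by move=> ? ? _ _; exact: set1_inj.
  rewrite -gmu [RHS](bigID (mem (S h))) /= [X in _ + X]big1 ?addr0; last exact: gS.
  by apply: eq_bigr => r _; exact: f1.
move=> h; pose cr r := c r (sload g r).
have [r0 r0S] := set0Pn _ (S0 h).
(* The multiplier of [h] is the least cost over its resources, which every used resource attains. *)
case: (@Order.TotalTheory.arg_minP _ _ _ r0 (mem (S h)) cr r0S) => r1 r1S r1min.
exists (cr r1) => s; rewrite stratE => /imsetP[r rS ->].
have -> : strat_cost f [set r]%SET = cr r.
  rewrite /strat_cost big_set1 loadE /cr /c max_r //; exact: sload_ge0 gF.
split; last exact: r1min.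
rewrite f1 => gr; apply/eqP; rewrite eq_le r1min // andbT.
exact: gE h r r1 r1S gr.
Qed.

End SingletonGame.

(** * Induction on the construction of the game *)

Theorem theorem5p2 (R : realType) (G : cgame R) :
  product_union G -> has_MES G.
Proof.
elim=> {G} [G|G1 G2 _ M1 _ M2|G1 G2 _ M1 _ M2|G G' _ M iso].
- exact: singleton_game_MES.
- exact: prod_game_MES.
- exact: union_game_MES.
- exact: game_iso_MES iso M.
Qed.
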